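(* Let $\phi:\mathbb{R}^d\to\mathbb{R}$ be bounded below, twice continuously differentiable, with $M$-Lipschitz continuous gradient ($M>0$), and $m$-strongly convex with $0<m\le M$. Let $f:\mathbb{R}^d\to\mathbb{R}$, $g:\mathbb{R}^d\to\mathbb{R}^d$ and constants $\epsilon_f,\epsilon_g\ge 0$ satisfy $|f(x)-\phi(x)|\le\epsilon_f$ and $\|g(x)-\nabla\phi(x)\|\le\epsilon_g$ for all $x\in\mathbb{R}^d$. Consider the BFGS method with errors (described in the context) with lengthening parameter $l>0$ satisfying $l>2\epsilon_g/m$. Let $\theta_k$ be the angle between $p_k=-H_kg(x_k)$ and $-g(x_k)$. For a given $q\in(0,1)$, let $$\beta_0=\frac{1}{1-q}\left[\mathrm{tr}(B_0)-\log\det(B_0)+\widehat M-1-\log\widehat m\right],\qquad \beta_1=e^{-\beta_0/2},$$ where $B_0=H_0^{-1}$, $\widehat m=m-2\epsilon_g/l$, $\widehat M=M+2\epsilon_g/l$, and define $$J=\{j\in\mathbb{N}:\ \cos\theta_j\ge\beta_1\},\qquad J_k=J\cap\{0,1,\dots,k-1\}.$$ Then $|J_k|\ge qk$ for all $k$.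
   Context: $\|\cdot\|$ is the Euclidean norm; $\mathbb{N}=\{0,1,2,\dots\}$. BFGS method with errors. Inputs: $f$, $g$, constants $0<c_1<c_2<1$, lengthening parameter $l>0$, starting point $x_0\in\mathbb{R}^d$, symmetric positive definite $H_0\in\mathbb{R}^{d\times d}$. For $k=0,1,2,\dots$: (1) $p_k=-H_kg(x_k)$. (2) Line search: attempt to find $\alpha>0$ such that $f(x_k+\alpha p_k)\le f(x_k)+c_1\alpha p_k^Tg(x_k)$ and $p_k^Tg(x_k+\alpha p_k)\ge c_2p_k^Tg(x_k)$. If the attempt succeeds, $\alpha_k$ is the $\alpha$ found; otherwise $\alpha_k=0$. (3) If $\|\alpha_kp_k\|\ge l$, set $s_k=\alpha_kp_k$; otherwise set $s_k=l\,p_k/\|p_k\|$. In both cases $y_k=g(x_k+s_k)-g(x_k)$. (4) $H_{k+1}=(I-\rho_ks_ky_k^T)H_k(I-\rho_ky_ks_k^T)+\rho_ks_ks_k^T$ with $\rho_k=1/(s_k^Ty_k)$. (5) $x_{k+1}=x_k+\alpha_kp_k$. It is understood that $g(x_k)\ne0$ for all $k$, so that all steps are defined. *)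

(* Defs.v *)
From HB Require Import structures.
From mathcomp Require Import all_boot all_order all_algebra finmap.
From mathcomp Require Import all_classical all_reals all_analysis.

Set Implicit Arguments.
Unset Strict Implicit.
Unset Printing Implicit Defensive.

Import Order.TTheory GRing.Theory Num.Theory.
Import numFieldNormedType.Exports.

Local Open Scope classical_set_scope.
Local Open Scope ring_scope.

Section EuclideanSpace.
Context {R : realType} {d : nat}.
Implicit Types (u v : 'cV[R]_d) (phi : 'cV[R]_d -> R).

Definition dot u v : R := (u^T *m v) 0 0.

(* The norm [`|u|] of the library is the sup norm; it is only used here through
   the topology and the differentiability it induces, which do not depend on
   the choice of a norm. *)
Definition enorm u : R := Num.sqrt (dot u u).

Definition angle u v : R := acos (dot u v / (enorm u * enorm v)).

Definition posdefmx (A : 'M[R]_d) : Prop :=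
  forall u, u != 0 -> 0 < dot u (A *m u).

Definition grad phi (x : 'cV[R]_d) : 'cV[R]_d :=
  \col_i 'D_(delta_mx i 0) phi x.

Definition hessian phi (x : 'cV[R]_d) : 'M[R]_d :=
  \matrix_(i, j) 'D_(delta_mx j 0) (fun z => grad phi z i 0) x.

(* The derivative operator ['D_v] is total, hence the explicit requirement
   that phi and its gradient be differentiable. *)
Definition twice_continuously_differentiable phi : Prop :=
  [/\ forall x, differentiable phi x,
      forall x, differentiable (grad phi) x
    & continuous (hessian phi)].

Definition lipschitz_gradient (M : R) phi : Prop :=
  forall x y, enorm (grad phi x - grad phi y) <= M * enorm (x - y).

Definition strongly_convex (m : R) phi : Prop :=
  forall (x y : 'cV[R]_d) (t : R), 0 <= t <= 1 ->
    phi (t *: x + (1 - t) *: y) <=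
      t * phi x + (1 - t) * phi y - m / 2 * t * (1 - t) * enorm (x - y) ^+ 2.

End EuclideanSpace.

Section BFGS.
Context {R : realType} {d : nat}.
Variables (f : 'cV[R]_d -> R) (g : 'cV[R]_d -> 'cV[R]_d).
Variables (c1 c2 l : R).

Definition direction (H : 'M[R]_d) (x : 'cV[R]_d) : 'cV[R]_d := - (H *m g x).

Definition armijo_wolfe (x p : 'cV[R]_d) (a : R) : Prop :=
  f (x + a *: p) <= f x + c1 * a * dot p (g x) /\
  c2 * dot p (g x) <= dot p (g (x + a *: p)).

(* The line search is an unspecified procedure that may fail even when a
   suitable steplength exists. *)
Definition line_search (x p : 'cV[R]_d) (a : R) : Prop :=
  (0 < a /\ armijo_wolfe x p a) \/ a = 0.

Definition lengthened_step (p : 'cV[R]_d) (a : R) : 'cV[R]_d :=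
  if l <= enorm (a *: p) then a *: p else (l / enorm p) *: p.

Definition bfgs_update (H : 'M[R]_d) (s y : 'cV[R]_d) : 'M[R]_d :=
  let rho := 1 / dot s y in
  (1%:M - rho *: (s *m y^T)) *m H *m (1%:M - rho *: (y *m s^T))
    + rho *: (s *m s^T).

(* [x], [H] and [alpha] are the iterates, the inverse Hessian approximations
   and the steplengths of a run started from [x0] and [H0]. *)
Definition bfgs_run (x0 : 'cV[R]_d) (H0 : 'M[R]_d)
    (x : nat -> 'cV[R]_d) (H : nat -> 'M[R]_d) (alpha : nat -> R) : Prop :=
  [/\ x 0%N = x0, H 0%N = H0
    & forall k : nat,
        let p := direction (H k) (x k) in
        let s := lengthened_step p (alpha k) in
        let y := g (x k + s) - g (x k) in
        [/\ line_search (x k) p (alpha k),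
            H k.+1 = bfgs_update (H k) s y
          & x k.+1 = x k + alpha k *: p]].

End BFGS.

(* Main.v *)
(** The potential psi(B) = tr B - ln det B of the direct approximations
    B_k = H_k^-1 drives the proof. It is at least d on positive definite
    matrices, and a BFGS step changes it by at most
    Mhat - 1 - ln mhat + ln cos^2 theta_k, as soon as
    mhat |s|^2 <= s.y and |y|^2 <= Mhat s.y. Hence every index outside J costs
    beta0 and there can be at most (1 - q) k of them below k.

    For the curvature bounds, strong convexity and the Lipschitz gradient place
    the exact gradient difference in the ball of centre (m + M)/2 s and radius
    (M - m)/2 |s|. Since |s| >= l, the errors move it by at most
    2 epsg <= (2 epsg / l) |s|, so y lies in the ball with the same centre
    attached to mhat and Mhat. *)

Require Import Defs.
From HB Require Import structures.
From mathcomp Require Import all_boot all_order all_algebra finmap.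
From mathcomp Require Import all_classical all_reals all_analysis.
From mathcomp Require Import ring lra.

Set Implicit Arguments.
Unset Strict Implicit.
Unset Printing Implicit Defensive.

Import Order.TTheory GRing.Theory Num.Theory.
Import numFieldNormedType.Exports.

Local Open Scope classical_set_scope.
Local Open Scope ring_scope.

(** * Euclidean inner product and norm on column vectors *)

Section DotProduct.
Context {R : realType} {d : nat}.
Implicit Types (u v w : 'cV[R]_d) (A : 'M[R]_d).

Lemma trmx_mul_dot u v : u^T *m v = (dot u v)%:M.
Proof. by rewrite [LHS]mx11_scalar. Qed.

Lemma dotC u v : dot u v = dot v u.
Proof. by rewrite /dot -[u^T *m v]trmxK trmx_mul trmxK mxE. Qed.

Lemma dotDr u v w : dot u (v + w) = dot u v + dot u w.
Proof. by rewrite /dot mulmxDr mxE. Qed.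

Lemma dotZr a u v : dot u (a *: v) = a * dot u v.
Proof. by rewrite /dot -scalemxAr mxE. Qed.

Lemma dotNr u v : dot u (- v) = - dot u v.
Proof. by rewrite /dot mulmxN mxE. Qed.

Lemma dotBr u v w : dot u (v - w) = dot u v - dot u w.
Proof. by rewrite dotDr dotNr. Qed.

Lemma dot0r u : dot u 0 = 0.
Proof. by rewrite /dot mulmx0 mxE. Qed.

Lemma dotDl u v w : dot (u + v) w = dot u w + dot v w.
Proof. by rewrite dotC dotDr !(dotC w). Qed.

Lemma dotZl a u v : dot (a *: u) v = a * dot u v.
Proof. by rewrite dotC dotZr dotC. Qed.

Lemma dotNl u v : dot (- u) v = - dot u v.
Proof. by rewrite dotC dotNr dotC. Qed.

Lemma dotBl u v w : dot (u - v) w = dot u w - dot v w.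
Proof. by rewrite dotDl dotNl. Qed.

Definition dot_linE :=
  (dotDr, dotBr, dotZr, dotNr, dotDl, dotBl, dotZl, dotNl).

Lemma dot_mulmxl A u v : dot (A *m u) v = dot u (A^T *m v).
Proof. by rewrite /dot trmx_mul mulmxA. Qed.

Lemma dotE u v : dot u v = \sum_i u i 0 * v i 0.
Proof. by rewrite /dot mxE; apply: eq_bigr => i _; rewrite mxE. Qed.

Lemma dot_ge0 u : 0 <= dot u u.
Proof. by rewrite dotE sumr_ge0// => i _; rewrite -expr2 sqr_ge0. Qed.

Lemma dot_eq0 u : (dot u u == 0) = (u == 0).
Proof.
apply/idP/eqP => [|->]; last by rewrite dot0r.
rewrite dotE psumr_eq0 => [/allP u0|i _]; last by rewrite -expr2 sqr_ge0.
apply/colP => i; rewrite mxE; apply/eqP.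
by have := u0 i (mem_index_enum _); rewrite mulf_eq0 orbb.
Qed.

Lemma dot_gt0 u : (0 < dot u u) = (u != 0).
Proof. by rewrite lt_def dot_eq0 dot_ge0 andbT. Qed.

Lemma enorm_ge0 u : 0 <= enorm u.
Proof. exact: sqrtr_ge0. Qed.

Lemma sqr_enorm u : enorm u ^+ 2 = dot u u.
Proof. by rewrite /enorm sqr_sqrtr ?dot_ge0. Qed.

Lemma enorm_gt0 u : (0 < enorm u) = (u != 0).
Proof. by rewrite /enorm sqrtr_gt0 dot_gt0. Qed.

Lemma enormN u : enorm (- u) = enorm u.
Proof. by rewrite /enorm dotNl dotNr opprK. Qed.

Lemma enormZ a u : enorm (a *: u) = `|a| * enorm u.
Proof.
by rewrite /enorm dotZl dotZr mulrA -expr2 sqrtrM ?sqr_ge0// sqrtr_sqr.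
Qed.

Lemma cauchy_schwarz u v : `|dot u v| <= enorm u * enorm v.
Proof.
rewrite -[leRHS]ger0_norm ?mulr_ge0 ?enorm_ge0//.
rewrite -ler_sqr ?nnegrE// !real_normK ?num_real// exprMn !sqr_enorm.
have [->|v0] := eqVneq v 0.
  by rewrite !dot0r mulr0 expr0n.
(* Up to the factor [dot v v], this is the component of [u] orthogonal to [v]; its squared norm is
   [dot v v] times the wanted gap. *)
have := dot_ge0 (dot v v *: u - dot u v *: v).
rewrite !dot_linE (dotC v u) => h.
have : 0 <= dot v v * (dot u u * dot v v - dot u v ^+ 2).
  by apply: le_trans h _; rewrite le_eqVlt; apply/orP; left; apply/eqP; ring.
by rewrite pmulr_rge0 ?dot_gt0// subr_ge0.
Qed.

Lemma dot_le_enorm u v : dot u v <= enorm u * enorm v.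
Proof. exact: le_trans (ler_norm _) (cauchy_schwarz u v). Qed.

Lemma enormD_le u v : enorm (u + v) <= enorm u + enorm v.
Proof.
rewrite -ler_sqr ?nnegrE ?addr_ge0 ?enorm_ge0// sqrrD !sqr_enorm !dot_linE.
by have := dot_le_enorm u v; rewrite (dotC v u) => h; lra.
Qed.

End DotProduct.

(** * Determinants of rank-one perturbations and of positive definite matrices *)

(** One bordered matrix is factored in two ways, eliminating either diagonal block; comparing
    determinants gives the formula. *)
Lemma det_rank1D (R : comPzRingType) n (u v : 'cV[R]_n) :
  \det (1%:M + u *m v^T) = 1 + (v^T *m u) 0 0.
Proof.
have E1 : block_mx 1%:M (- v^T) u 1%:M =
    block_mx 1%:M 0 u 1%:M *m block_mx 1%:M (- v^T) 0 (1%:M + u *m v^T)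
    :> 'M[R]_(1 + n).
  rewrite mulmx_block !mul1mx !mul0mx ?mulmx0 !mulmx1 !addr0 !mulmxN.
  by rewrite addrC addrK.
have E2 : block_mx 1%:M (- v^T) u 1%:M =
    block_mx (1%:M + v^T *m u) (- v^T) 0 1%:M *m block_mx 1%:M 0 u 1%:M
    :> 'M[R]_(1 + n).
  rewrite mulmx_block !mul1mx !mul0mx ?mulmx0 !mulmx1 !add0r.
  by rewrite !mulNmx addrK.
have := congr1 determinant E1.
rewrite {1}E2 !det_mulmx !det_ublock !det_lblock !det1 !mul1r !mulr1 => <-.
by rewrite det_mx11 !mxE eqxx.
Qed.

Lemma ln_le_subr1 (R : realType) (a : R) : 0 < a -> ln a <= a - 1.
Proof.
move=> a0; have := @le_ln1Dx R (a - 1); rewrite [1 + _]addrC subrK; apply; lra.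
Qed.

(* Block elimination: the Schur complement of the leading entry [a] is positive
   definite with trace at most that of the trailing block. *)
Lemma posdefmx_ln_det (R : realType) n (A : 'M[R]_n) :
  A^T = A -> posdefmx A -> 0 < \det A /\ ln (\det A) <= \tr A - n%:R.
Proof.
elim: n A => [|n IH] A symA pdA.
  by rewrite det_mx00 ln1 /mxtrace big_ord0 subrr.
rewrite -[n.+1]/(1 + n)%N in A symA pdA *.
set a := ulsubmx A 0 0; set b := dlsubmx A; set D := drsubmx A.
have AE : A = block_mx a%:M b^T b D.
  rewrite -[LHS]submxK /b; congr block_mx; first by rewrite [LHS]mx11_scalar.
  by rewrite trmx_dlsub symA.
have symD : D^T = D by rewrite /D trmx_drsub symA.
have quad (t : R) (u : 'cV_n) : dot (col_mx t%:M u) (A *m col_mx t%:M u) =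
    a * t ^+ 2 + 2 * t * dot b u + dot u (D *m u).
  rewrite {1}/dot AE mul_block_col tr_col_mx mul_row_col tr_scalar_mx.
  rewrite mxE -[X in _ + X]/(dot _ _) [b *m t%:M]mul_mx_scalar dotDr dotZr trmx_mul_dot.
  by rewrite -scalar_mxM mul_scalar_mx !mxE eqxx !mulr1n (dotC u b); ring.
have a_gt0 : 0 < a.
  have := pdA (col_mx 1%:M 0); rewrite quad mulmx0 !dot0r; rewrite expr1n.
  rewrite mulr1 mulr0 !addr0; apply; apply/eqP => /colP/(_ (lshift n 0)).
  by rewrite col_mxEu !mxE eqxx; apply/eqP/oner_neq0.
set S := D - a^-1 *: (b *m b^T).
have symS : S^T = S.
  by rewrite linearB/= linearZ/= trmx_mul trmxK symD.
have pdS : posdefmx S.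
  (* For fixed [u], the first coordinate [- (dot b u / a)] minimises the quadratic form of [A], and
     the minimum is the quadratic form of [S]. *)
  move=> u u0; have := pdA (col_mx (- (dot b u / a))%:M u).
  have -> : dot u (S *m u) = dot u (D *m u) - dot b u ^+ 2 / a.
    rewrite mulmxBl dotBr -scalemxAl -mulmxA trmx_mul_dot mul_mx_scalar.
    rewrite !dotZr (dotC u b); ring.
  have -> : dot u (D *m u) - dot b u ^+ 2 / a =
    a * (- (dot b u / a)) ^+ 2 + 2 * (- (dot b u / a)) * dot b u + dot u (D *m u).
    by field; rewrite gt_eqF.
  rewrite quad; apply; apply: contraNneq u0 => /(congr1 dsubmx).
  by rewrite col_mxKd linear0 => ->.
have [detS lnS] := IH S symS pdS.
have detA : \det A = a * \det S.
  have -> : A = block_mx 1%:M 0 (a^-1 *: b) 1%:M *m block_mx a%:M b^T 0 S.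
    rewrite mulmx_block !mul1mx !mul0mx ?mulmx0 !addr0 AE /S.
    congr block_mx; first by rewrite mul_mx_scalar scalerA mulfV ?gt_eqF// scale1r.
    by rewrite -scalemxAl addrC subrK.
  by rewrite det_mulmx det_lblock det_ublock !det1 !mul1r det_scalar1.
have trS : \tr S <= \tr D.
  rewrite /S raddfB /= mxtraceZ mxtrace_mulC trace_mx11 -/(dot b b).
  by rewrite lerBlDr lerDl mulr_ge0 ?dot_ge0// invr_ge0 ltW.
split; first by rewrite detA mulr_gt0.
rewrite detA lnM ?posrE// AE mxtrace_block mxtrace_scalar mulr1n natrD.
by have := ln_le_subr1 a_gt0; lra.
Qed.

(** * The BFGS update written for [B], the inverse of [H] *)

Section DirectUpdate.
Context {R : realType} {d : nat}.
Variables (H B : 'M[R]_d) (s y : 'cV[R]_d).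
Hypotheses (symB : B^T = B) (pdB : posdefmx B) (HB : H *m B = 1%:M).
Hypotheses (s_neq0 : s != 0) (sy_gt0 : 0 < dot s y).

Let sigma := dot s (B *m s).

Let sigma_gt0 : 0 < sigma.
Proof. exact: pdB. Qed.

(** The inverse of [bfgs_update H s y]. Unlike the recursion on [H], this form gives trace and
    determinant explicitly. *)
Definition direct_update : 'M[R]_d :=
  B - sigma^-1 *: (B *m s *m (B *m s)^T) + (dot s y)^-1 *: (y *m y^T).

(* Powell's product form, which exhibits the rank-two update as a congruence. *)
Let tau := Num.sqrt ((dot s y)^-1 / sigma).
Let v := tau *: y - sigma^-1 *: (B *m s).
Let W : 'M[R]_d := 1%:M + s *m v^T.

Let sqr_tau : tau ^+ 2 = (dot s y)^-1 / sigma.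
Proof. by rewrite sqr_sqrtr// divr_ge0 ?invr_ge0 ?ltW. Qed.

Let direct_update_congr : direct_update = W^T *m B *m W.
Proof.
have trW : W^T = 1%:M + v *m s^T.
  by rewrite /W [LHS]linearD /= trmx1 trmx_mul trmxK.
rewrite trW /W mulmxDl mul1mx mulmxDl !mulmxDr !mulmx1 !mulmxA.
have -> : v *m s^T *m B *m s *m v^T = sigma *: (v *m v^T).
  by rewrite -(mulmxA _ B) -(mulmxA v) trmx_mul_dot mul_mx_scalar scalemxAl.
have -> : v *m s^T *m B = v *m (B *m s)^T by rewrite trmx_mul symB mulmxA.
set c := B *m s.
have outerE (a b : 'cV[R]_d) i j : (a *m b^T) i j = a i 0 * b j 0.
  by rewrite mxE big_ord1 mxE.
(* Trading [(dot s y)^-1] for [tau] leaves [sigma] as the only denominator, so the identity can be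
   checked entrywise. *)
have rho_tau : (dot s y)^-1 = sigma * tau ^+ 2.
  by rewrite sqr_tau; field; rewrite !gt_eqF.
rewrite /direct_update /v -/c rho_tau; clearbody c; apply/matrixP => i j.
by rewrite !(outerE, mxE); field; rewrite gt_eqF.
Qed.

(** By [det_rank1D] the left side is the determinant of [W], so this yields both the determinant of
    the update and the invertibility of [W]. *)
Let dot_vs : 1 + dot v s = tau * dot s y.
Proof.
rewrite /v dotBl !dotZl (dotC y) (dotC _ s) -/sigma mulVf ?gt_eqF//; ring.
Qed.

Lemma det_direct_update : \det direct_update = \det B * (dot s y / sigma).
Proof.
rewrite direct_update_congr !det_mulmx det_tr det_rank1D -/(dot v s) dot_vs.
rewrite mulrAC mulrC -expr2 exprMn sqr_tau; congr (_ * _).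
by field; rewrite !gt_eqF.
Qed.

Lemma mxtrace_direct_update : \tr direct_update =
  \tr B - dot (B *m s) (B *m s) / sigma + dot y y / dot s y.
Proof.
rewrite /direct_update raddfD raddfB /= !mxtraceZ !(mxtrace_mulC _ (_^T)).
by rewrite !trace_mx11 -!/(dot _ _) !(mulrC _^-1).
Qed.

Lemma direct_update_sym : direct_update^T = direct_update.
Proof. by rewrite /direct_update !linearD/= linearN/= !linearZ/= !trmx_mul !trmxK symB. Qed.

(** A congruence by an invertible matrix preserves positive definiteness, and [W] has determinant
    [tau * dot s y], which is positive. *)
Lemma direct_update_posdef : posdefmx direct_update.
Proof.
move=> u u_neq0; rewrite direct_update_congr -!mulmxA -dot_mulmxl.
apply: pdB; apply: contraNneq u_neq0 => Wu0.
have Wunit : W \in unitmx.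
  rewrite unitmxE det_rank1D -/(dot v s) dot_vs unitfE mulf_neq0 ?gt_eqF//.
  by rewrite sqrtr_gt0 divr_gt0 ?invr_gt0.
by rewrite -[u](mulKmx Wunit) Wu0 mulmx0.
Qed.

(** The secant equation [Us] makes the product collapse: multiplying by the left factor of
    [bfgs_update] cancels the [y] term, and the term in [s *m s^T] then restores what the right
    factor removed. A one-sided inverse suffices for square matrices. *)
Lemma bfgs_update_inv : bfgs_update H s y *m direct_update = 1%:M.
Proof.
apply/mulmx1C.
have BH : B *m H = 1%:M := mulmx1C HB.
have Us : direct_update *m s = y.
  rewrite /direct_update mulmxDl mulmxBl -!scalemxAl -!mulmxA trmx_mul symB.
  rewrite -!mulmxA !trmx_mul_dot !mul_mx_scalar -/sigma (dotC y).
  rewrite -scalemxAr !scalerA !mulVf ?gt_eqF// !scale1r.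
  by rewrite subrr add0r.
rewrite /bfgs_update mul1r; set rho := (dot s y)^-1.
rewrite [LHS]mulmxDr -scalemxAr !mulmxA Us.
rewrite [direct_update *m (_ - _)]mulmxBr mulmx1 -scalemxAr mulmxA Us.
have -> : direct_update - rho *: (y *m y^T) =
    B - sigma^-1 *: (B *m s *m (B *m s)^T) by rewrite /direct_update addrK.
rewrite [_ *m H]mulmxBl BH -scalemxAl trmx_mul symB -!mulmxA BH mulmx1.
rewrite [B *m _]mulmxA; set c := B *m s.
rewrite [X in X + _]mulmxBl mul1mx [X in _ - X + _]mulmxBr mulmx1.
rewrite -scalemxAl -scalemxAr -[c *m s^T *m _]mulmxA [s^T *m _]mulmxA.
rewrite trmx_mul_dot mul_scalar_mx -scalemxAr [rho *: (dot s y *: _)]scalerA.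
rewrite mulVf ?gt_eqF// scale1r; clearbody c.
by apply/matrixP => i j; rewrite !mxE; ring.
Qed.

End DirectUpdate.

(** * Quadratic bounds on [phi] and the location of exact gradient differences *)

Section GradientBounds.
Context {R : realType} {d : nat}.
Implicit Types (phi : 'cV[R]_d -> R) (x y u v w : 'cV[R]_d).

Lemma dot_grad phi x v : differentiable phi x ->
  dot (grad phi x) v = 'D_v phi x.
Proof.
move=> dphi; have vE : v = \sum_i v i 0 *: delta_mx i 0.
  by rewrite [LHS]matrix_sum_delta; apply: eq_bigr => i _; rewrite big_ord1.
rewrite deriveE// {2}vE linear_sum dotE; apply: eq_bigr => i _.
by rewrite linearZ mxE deriveE//= mulrC.
Qed.

Lemma is_derive_line phi x v (t : R) : differentiable phi (x + t *: v) ->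
  is_derive t 1 (fun r : R => phi (x + r *: v)) (dot (grad phi (x + t *: v)) v).
Proof.
move=> dphi; rewrite dot_grad//; have : derivable phi (x + t *: v) v by exact: diff_derivable.
rewrite /derivable /derive => cphi.
have E : (fun r : R => r^-1 *: (phi (r *: v + (x + t *: v)) - phi (x + t *: v)))
  = (fun r : R => r^-1 *: (phi (x + (r *: 1 + t) *: v) - phi (x + t *: v))).
  by apply/funext => r; rewrite [r *: 1]mulr1 scalerDl addrCA.
by split; rewrite /derivable/derive -E.
Qed.

(** The claim is [k 1 <= k 0]; by the mean value theorem it follows from [dk c <= 0], which is
    Cauchy-Schwarz and the Lipschitz bound. *)
Lemma lipschitz_gradient_upper (M : R) phi x v :
  (forall z, differentiable phi z) -> lipschitz_gradient M phi ->
  phi (x + v) <= phi x + dot (grad phi x) v + M / 2 * dot v v.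
Proof.
move=> dphi lip.
pose k (t : R) :=
  phi (x + t *: v) - t * dot (grad phi x) v - t ^+ 2 * (M / 2 * dot v v).
pose dk (t : R) := dot (grad phi (x + t *: v)) v - dot (grad phi x) v -
  2 * t * (M / 2 * dot v v).
have kd (t : R) : is_derive t 1 k (dk t).
  have h := is_derive_line (dphi (x + t *: v)).
  apply: is_derive_eq.
  rewrite /dk !scaler0 !add0r; congr (_ - _ - _); rewrite /GRing.scale/=; ring.
have k_cont : {within `[0, 1], continuous k}.
  by apply: derivable_within_continuous => t _; have [] := kd t.
have [c c01 kE] := MVT ltr01 (fun t _ => kd t) k_cont.
move: c01; rewrite in_itv/= => /andP[c0 c1].
have : dk c <= 0.
  rewrite /dk -dotBl.
  apply: le_trans (_ : c * (M * dot v v) - 2 * c * (M / 2 * dot v v) <= 0).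
    rewrite lerD2r; apply: le_trans (dot_le_enorm _ _) _.
    rewrite -sqr_enorm expr2 !mulrA ler_wpM2r ?enorm_ge0//.
    apply: le_trans (lip _ _) _.
    by rewrite [x + _]addrC addrK enormZ gtr0_norm// mulrCA mulrA.
  by rewrite le_eqVlt; apply/orP; left; apply/eqP; field.
move: kE; rewrite /k scale1r scale0r addr0; lra.
Qed.

(** Strong convexity on the segment from [x] to [x + v] bounds the difference quotient at [t] by
    [slope t]; let [t] decrease to 0. *)
Lemma strongly_convex_lower (m : R) phi x v :
  differentiable phi x -> strongly_convex m phi ->
  phi x + dot (grad phi x) v + m / 2 * dot v v <= phi (x + v).
Proof.
move=> dphi conv.
pose h (t : R) := phi (x + t *: v).
have hd : is_derive (0 : R) 1 h (dot (grad phi x) v).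
  by have := @is_derive_line phi x v 0; rewrite scale0r addr0; apply.
have [hd1 hd2] := hd.
have cvg1 : (fun t : R => t^-1 *: (h (t *: (1 : R) + 0) - h 0)) @ 0^'+ -->
    dot (grad phi x) v.
  by apply: cvg_dnbhs_at_right; rewrite -hd2; exact: hd1.
pose slope (t : R) :=
  phi (x + v) - phi x - m / 2 * dot v v + t * (m / 2 * dot v v).
have cvg2 : slope @ 0^'+ --> slope 0.
  apply: cvg_at_right_filter; apply: cvgD; first exact: cvg_cst.
  by apply: cvgMl; exact: cvg_id.
suff : dot (grad phi x) v <= slope 0 by rewrite /slope; lra.
apply: (ler_cvg_to cvg1 cvg2); near=> t.
have t0 : 0 < t by near: t; exact: nbhs_right_gt.
have t1 : t < 1 by near: t; exact: nbhs_right_lt.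
rewrite addr0 [t%:A]mulr1 -[_ *: _]/(_ * _) mulrC ler_pdivrMr//.
have /= := conv (x + v) x t; rewrite ltW// ltW// => /(_ isT).
have -> : t *: (x + v) + (1 - t) *: x = x + t *: v.
  by rewrite scalerDr addrAC -scalerDl subrKC scale1r.
rewrite [x + v - x]addrAC subrr add0r sqr_enorm /h /slope scale0r addr0; lra.
Unshelve. all: by end_near. Qed.

(* Adding the quadratic bounds at [y + w] and [x - w] gives
   [2 E.w - (M - m) |w|^2 <= E.(x - y)]; optimise over [w] parallel to [E]. *)
Lemma grad_diff_interp (m M : R) phi x y
    (E := grad phi x - grad phi y - m *: (x - y)) :
  m <= M -> (forall z, differentiable phi z) ->
  lipschitz_gradient M phi -> strongly_convex m phi ->
  dot E E <= (M - m) * dot E (x - y).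
Proof.
move=> mM dphi lip conv; set s := x - y in E *.
have key w : 2 * dot E w - (M - m) * dot w w <= dot E s.
  have := strongly_convex_lower (w - s) (dphi x) conv.
  have := strongly_convex_lower (s - w) (dphi y) conv.
  have := lipschitz_gradient_upper y w dphi lip.
  have := lipschitz_gradient_upper x (- w) dphi lip.
  have -> : x + (w - s) = y + w by apply/colP => i; rewrite !mxE; ring.
  have -> : y + (s - w) = x - w by apply/colP => i; rewrite !mxE; ring.
  by clearbody s; rewrite /E !dot_linE (dotC w s); lra.
(* When [m = M] the left side of [key] is linear in [w], so a nonzero [E] is refuted by a [w] with
   [2 * dot E w = dot E s + 1]. *)
clearbody E s; have [L0|L0] := eqVneq (M - m) 0.
  have [->|E0] := eqVneq (dot E E) 0; first by rewrite L0 mul0r.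
  have := key (((dot E s + 1) / (2 * dot E E)) *: E).
  rewrite L0 mul0r subr0 dotZr.
  have -> : 2 * ((dot E s + 1) / (2 * dot E E) * dot E E) = dot E s + 1.
    by field.
  by rewrite gerDl ler10.
have Lgt0 : 0 < M - m by rewrite lt_def L0 subr_ge0.
(* This [w] maximises the left side of [key]. *)
have := key ((M - m)^-1 *: E).
rewrite !dot_linE.
have -> : 2 * ((M - m)^-1 * dot E E) -
  (M - m) * ((M - m)^-1 * ((M - m)^-1 * dot E E)) = dot E E / (M - m) by field.
by rewrite ler_pdivrMr// mulrC.
Qed.

End GradientBounds.

(** * Curvature bounds for the inexact gradient differences *)

Section NoisyCurvature.
Context {R : realType} {d : nat}.
Variables (phi : 'cV[R]_d -> R) (g : 'cV[R]_d -> 'cV[R]_d) (m M eps l : R).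
Hypotheses (m_le_M : m <= M) (dphi : forall z, differentiable phi z).
Hypotheses (lip : lipschitz_gradient M phi) (conv : strongly_convex m phi).
Hypotheses (eps_ge0 : 0 <= eps) (l_gt0 : 0 < l).
Hypothesis g_error : forall z, enorm (g z - grad phi z) <= eps.
Variables (x s : 'cV[R]_d).
Hypothesis l_le_s : l <= enorm s.

Let y := g (x + s) - g x.
Let mhat := m - 2 * eps / l.
Let Mhat := M + 2 * eps / l.

Lemma noisy_grad_diff_ball :
  enorm (y - ((mhat + Mhat) / 2) *: s) <= (Mhat - mhat) / 2 * enorm s.
Proof.
have L_ge0 : 0 <= (M - m) / 2 by rewrite divr_ge0// subr_ge0.
pose yt := grad phi (x + s) - grad phi x.
have -> : y - ((mhat + Mhat) / 2) *: s =
    ((g (x + s) - grad phi (x + s)) - (g x - grad phi x)) +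
    (yt - ((m + M) / 2) *: s).
  apply/colP => i; rewrite /y /yt /mhat /Mhat !mxE; field.
  by rewrite gt_eqF.
have ball : enorm (yt - ((m + M) / 2) *: s) <= (M - m) / 2 * enorm s.
  (* Completing the square turns [grad_diff_interp] into this ball. *)
  rewrite -ler_sqr ?nnegrE ?(mulr_ge0 L_ge0) ?enorm_ge0// exprMn !sqr_enorm.
  have := grad_diff_interp (x + s) x m_le_M dphi lip conv.
  rewrite [x + s - x]addrAC subrr add0r /= -/yt.
  by clearbody yt; rewrite !dot_linE (dotC s yt); lra.
apply: le_trans (enormD_le _ _) _.
have -> : (Mhat - mhat) / 2 * enorm s =
    2 * eps / l * enorm s + (M - m) / 2 * enorm s.
  by rewrite /Mhat /mhat; field; rewrite gt_eqF.
apply: lerD => //; apply: le_trans (enormD_le _ _) _; rewrite enormN.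
apply: le_trans (lerD (g_error _) (g_error _)) _.
have h : 1 <= enorm s / l by rewrite ler_pdivlMr// mul1r.
have := ler_wpM2l eps_ge0 h; lra.
Qed.

(** Cauchy-Schwarz against [s] in the ball: centre coefficient minus radius coefficient is
    [mhat]. *)
Lemma noisy_curvature_ge : mhat * dot s s <= dot s y.
Proof.
have ball := noisy_grad_diff_ball; clearbody y.
have := cauchy_schwarz s (y - ((mhat + Mhat) / 2) *: s).
rewrite ler_norml !dot_linE => /andP[h _].
have := ler_wpM2l (enorm_ge0 s) ball.
rewrite mulrCA -expr2 sqr_enorm; lra.
Qed.

(** Squaring the ball bound gives [dot y y <= Mhat * dot s y + mhat * (dot s y - Mhat * dot s s)].
    The last term is nonpositive by Cauchy-Schwarz in the ball and [0 < mhat]. *)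
Lemma noisy_curvature_le : 0 < mhat -> dot y y <= Mhat * dot s y.
Proof.
move=> mhat_gt0.
have mM : 0 <= Mhat - mhat.
  have : 0 <= 2 * eps / l by rewrite divr_ge0 ?mulr_ge0// ltW.
  by move: m_le_M; rewrite /Mhat /mhat; lra.
have ball := noisy_grad_diff_ball; clearbody y.
have := cauchy_schwarz s (y - ((mhat + Mhat) / 2) *: s).
rewrite ler_norml !dot_linE => /andP[_ h].
have := ler_wpM2l (enorm_ge0 s) ball.
rewrite mulrCA -expr2 sqr_enorm => h'.
have syM : 0 <= mhat * (Mhat * dot s s - dot s y).
  by apply: mulr_ge0; [exact: ltW | lra].
move: ball.
rewrite -ler_sqr ?nnegrE ?mulr_ge0 ?enorm_ge0 ?invr_ge0// exprMn !sqr_enorm.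
by rewrite !dot_linE (dotC y s); lra.
Qed.

End NoisyCurvature.

(** * Cosines of angles *)

Section CosAngle.
Context {R : realType} {d : nat}.
Implicit Types u v : 'cV[R]_d.

(** Cauchy-Schwarz keeps the quotient in [[-1, 1]], where [cos] inverts [acos]. *)
Lemma cos_angle u v : u != 0 -> v != 0 ->
  cos (angle u v) = dot u v / (enorm u * enorm v).
Proof.
move=> u0 v0; have n0 : 0 < enorm u * enorm v by rewrite mulr_gt0 ?enorm_gt0.
rewrite /angle acosK// in_itv/= -ler_norml normrM normfV (gtr0_norm n0).
by rewrite ler_pdivrMr// mul1r cauchy_schwarz.
Qed.

Lemma cos_angleZ (a b : R) u v : 0 < a -> 0 < b -> u != 0 -> v != 0 ->
  cos (angle (a *: u) (b *: v)) = cos (angle u v).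
Proof.
move=> a0 b0 u0 v0; rewrite !cos_angle ?scaler_eq0 ?gt_eqF//.
rewrite dotZl dotZr !enormZ !gtr0_norm//; field.
by rewrite !gt_eqF ?enorm_gt0.
Qed.

End CosAngle.

(** * The potential and its change in one update *)

Section Potential.
Context {R : realType} {d : nat}.
Implicit Types (B H : 'M[R]_d) (s y : 'cV[R]_d).

Definition potential B : R := \tr B - ln (\det B).

Lemma potential_ge_dim B : B^T = B -> posdefmx B -> d%:R <= potential B.
Proof.
by move=> symB pdB; rewrite /potential; have [_] := posdefmx_ln_det symB pdB; lra.
Qed.

Lemma posdefmx_unit B : B^T = B -> posdefmx B -> B \in unitmx.
Proof.
move=> symB pdB; rewrite unitmxE unitfE gt_eqF//.
by have [] := posdefmx_ln_det symB pdB.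
Qed.

Lemma invmx_sym B : B^T = B -> (invmx B)^T = invmx B.
Proof. by move=> symB; rewrite trmx_inv symB. Qed.

Lemma invmx_posdef B : B^T = B -> posdefmx B -> posdefmx (invmx B).
Proof.
move=> symB pdB u u0; have uB := posdefmx_unit symB pdB.
set w := invmx B *m u; have wE : B *m w = u by rewrite /w mulKVmx.
clearbody w; rewrite -wE dot_mulmxl symB; apply: pdB.
by apply: contraNneq u0 => w0; rewrite -wE w0 mulmx0.
Qed.

(* With [b := B s] the step changes the potential by [|y|^2 / s.y - ln (s.y / |s|^2)]
   and [- |b|^2 / s.b + ln (|b|^2 / s.b) + ln cos^2], where [ln t <= t - 1]. *)
Lemma potential_direct_update (mhat Mhat : R) B s y :
  B^T = B -> posdefmx B -> s != 0 -> 0 < mhat ->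
  mhat * dot s s <= dot s y -> dot y y <= Mhat * dot s y ->
  0 < cos (angle s (B *m s)) /\
  potential (direct_update B s y) <=
    potential B + (Mhat - 1 - ln mhat) + 2 * ln (cos (angle s (B *m s))).
Proof.
move=> symB pdB s0 mhat0 lo hi.
have ss0 : 0 < dot s s by rewrite dot_gt0.
have sy0 : 0 < dot s y by apply: lt_le_trans lo; rewrite mulr_gt0.
have sB0 : 0 < dot s (B *m s) by exact: pdB.
have Bs0 : B *m s != 0 by apply: contraTneq sB0 => ->; rewrite dot0r ltxx.
have bb0 : 0 < dot (B *m s) (B *m s) by rewrite dot_gt0.
have es0 : 0 < enorm s by rewrite enorm_gt0.
have eb0 : 0 < enorm (B *m s) by rewrite enorm_gt0.
have [detB _] := posdefmx_ln_det symB pdB.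
rewrite cos_angle//; split; first by rewrite divr_gt0 ?mulr_gt0.
rewrite /potential det_direct_update// mxtrace_direct_update//.
have lndet : ln (\det B * (dot s y / dot s (B *m s))) =
    ln (\det B) + (ln (dot s y) - ln (dot s (B *m s))).
  by rewrite lnM ?posrE ?divr_gt0// ln_div.
have lncos : ln (dot s (B *m s) / (enorm s * enorm (B *m s))) =
    ln (dot s (B *m s)) - (ln (enorm s) + ln (enorm (B *m s))).
  by rewrite ln_div ?posrE ?mulr_gt0// lnM.
rewrite lndet lncos.
have lnss : ln (dot s s) = 2 * ln (enorm s) by rewrite -sqr_enorm lnXn// mulr_natl.
have lnbb : ln (dot (B *m s) (B *m s)) = 2 * ln (enorm (B *m s)).
  by rewrite -sqr_enorm lnXn// mulr_natl.
have hiM : dot y y / dot s y <= Mhat by rewrite ler_pdivrMr.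
have lnlo : ln mhat + ln (dot s s) <= ln (dot s y).
  by rewrite -lnM ?posrE// ler_ln ?posrE ?mulr_gt0.
have := ln_le_subr1 (divr_gt0 bb0 sB0); rewrite ln_div ?posrE//; lra.
Qed.

End Potential.

(** * Lengthened steps, counting of indices, and the final bound *)

(** The length controls the gradient errors; the positive multiple preserves the angle, even when
    the line search fails and [a = 0]. *)
Lemma lengthened_stepE (R : realType) d (l : R) (p : 'cV[R]_d) (a : R) :
  0 < l -> 0 <= a -> p != 0 ->
  l <= enorm (lengthened_step l p a) /\
  exists2 c, 0 < c & lengthened_step l p a = c *: p.
Proof.
move=> l0 a0 p0; have ep : 0 < enorm p by rewrite enorm_gt0.
rewrite /lengthened_step; case: ifPn => [la|_]; split => //.
(* A zero steplength cannot reach this branch, since [l] is positive. *)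
- exists a => //; rewrite lt_def a0 andbT; apply: contraTneq la => ->.
  by rewrite enormZ normr0 mul0r -ltNge.
- by rewrite enormZ gtr0_norm ?divr_gt0// divfK ?gt_eqF.
- by exists (l / enorm p) => //; rewrite divr_gt0.
Qed.

Lemma card_fset_set_setIIS (J : set nat) k :
  #|` fset_set (J `&` `I_k.+1)| = (#|` fset_set (J `&` `I_k)| + `[< J k >])%N.
Proof.
have fin : finite_set (J `&` `I_k) by apply: finite_setIr; exact: finite_II.
rewrite IIS setIUr; case: asboolP => Jk.
  rewrite (_ : J `&` [set k] = [set k]); last by rewrite setIidr// => _ ->.
  rewrite setUC fset_setU1// cardfsU1 addnC; congr (_ + _)%N.
  by rewrite in_fset_set// memNset//= => -[_]; rewrite ltnn.
rewrite (_ : J `&` [set k] = set0) ?setU0 ?addn0//.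
by apply/seteqP; split => [j [Jj /= jk]|//]; apply: Jk; rewrite -jk.
Qed.

Theorem corollary3p10 (R : realType) (d : nat)
    (phi f : 'cV[R]_d -> R) (g : 'cV[R]_d -> 'cV[R]_d)
    (m M epsf epsg : R)
    (c1 c2 l : R) (x0 : 'cV[R]_d) (H0 : 'M[R]_d)
    (x : nat -> 'cV[R]_d) (H : nat -> 'M[R]_d) (alpha : nat -> R) (q : R)
    (phi_bounded_below : has_lbound (range phi))
    (phi_C2 : twice_continuously_differentiable phi)
    (M_gt0 : 0 < M) (phi_lipschitz : lipschitz_gradient M phi)
    (m_gt0 : 0 < m) (m_le_M : m <= M) (phi_convex : strongly_convex m phi)
    (epsf_ge0 : 0 <= epsf) (epsg_ge0 : 0 <= epsg)
    (f_error : forall z, `|f z - phi z| <= epsf)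
    (g_error : forall z, enorm (g z - grad phi z) <= epsg)
    (c1_gt0 : 0 < c1) (c1_lt_c2 : c1 < c2) (c2_lt1 : c2 < 1)
    (l_gt0 : 0 < l) (l_large : 2 * epsg / m < l)
    (H0_sym : H0^T = H0) (H0_posdef : posdefmx H0)
    (run : bfgs_run f g c1 c2 l x0 H0 x H alpha)
    (g_neq0 : forall k, g (x k) != 0)
    (q_gt0 : 0 < q) (q_lt1 : q < 1) :
  let theta (k : nat) := angle (direction g (H k) (x k)) (- g (x k)) in
  let B0 := invmx H0 in
  let mhat := m - 2 * epsg / l in
  let Mhat := M + 2 * epsg / l in
  let beta0 := 1 / (1 - q) * (\tr B0 - ln (\det B0) + Mhat - 1 - ln mhat) in
  let beta1 := expR (- beta0 / 2) in
  let J := [set j : nat | beta1 <= cos (theta j)] in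
  let Jk (k : nat) := J `&` `I_k in
  forall k : nat, q * k%:R <= (#|` fset_set (Jk k)|)%:R.

Proof.
move=> theta B0 mhat Mhat beta0 beta1 J Jk k.
have [_ H0E steps] := run.
have mhat_gt0 : 0 < mhat.
  by rewrite subr_gt0; move: l_large; rewrite !ltr_pdivrMr// (mulrC l).
pose C := Mhat - 1 - ln mhat.
have C_ge0 : 0 <= C.
  have := ln_le_subr1 mhat_gt0.
  have : 0 <= 2 * epsg / l by rewrite divr_ge0 ?mulr_ge0// ltW.
  by move: m_le_M; rewrite /C /Mhat {2}/mhat; lra.
have symB0 : B0^T = B0 := invmx_sym H0_sym.
have pdB0 : posdefmx B0 := invmx_posdef H0_sym H0_posdef.
(* A nonzero gradient estimate excludes dimension 0, so [potential B0], which is at least [d], is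
   positive. *)
have d_gt0 : (0 < d)%N.
  case: (posnP d) => // d0; have /eqP[] := g_neq0 0%N.
  by apply/colP => i; have := ltn_ord i; rewrite [X in (_ < X)%N]d0.
have psi0_gt0 : 0 < potential B0.
  by apply: lt_le_trans (potential_ge_dim symB0 pdB0); rewrite ltr0n.
have beta0E : beta0 = (potential B0 + C) / (1 - q).
  by rewrite /beta0 /potential /C; field; rewrite subr_eq0 gt_eqF.
(* The factor of [beta0] counts the indices below [j] outside [J]; each step adds at most [C] to the
   left side. *)
have inv j : exists B, [/\ B^T = B, posdefmx B, H j *m B = 1%:M
    & potential B + (j%:R - (#|` fset_set (Jk j)|)%:R) * beta0 <=
      potential B0 + j%:R * C].
  elim: j => [|j [B [symB pdB HB psiB]]].
    exists B0; split => //; first by rewrite H0E mulmxV ?posdefmx_unit.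
    rewrite /Jk (_ : `I_0 = set0) ?setI0 ?fset_set0 ?cardfs0; last exact: II0.
    by rewrite subrr !mul0r addr0.
  have [ls HS _] := steps j.
  set p := direction g (H j) (x j) in ls HS.
  set s := lengthened_step l p (alpha j) in HS.
  set y := g (x j + s) - g (x j) in HS.
  have BH : B *m H j = 1%:M := mulmx1C HB.
  have Bp : B *m p = - g (x j) by rewrite /p /direction mulmxN mulmxA BH mul1mx.
  have p0 : p != 0.
    by apply: contraNneq (g_neq0 j) => p0; rewrite -oppr_eq0 -Bp p0 mulmx0.
  have al_ge0 : 0 <= alpha j by case: ls => [[/ltW]|->].
  have [l_le_s [c c_gt0 sE]] := lengthened_stepE l_gt0 al_ge0 p0.
  rewrite -/s in l_le_s sE.
  have s0 : s != 0 by rewrite -enorm_gt0; exact: lt_le_trans l_le_s.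
  have [dphi _ _] := phi_C2.
  have lo : mhat * dot s s <= dot s y :=
    noisy_curvature_ge m_le_M dphi phi_lipschitz phi_convex epsg_ge0 l_gt0
      g_error (x j) l_le_s.
  have hi : dot y y <= Mhat * dot s y :=
    noisy_curvature_le m_le_M dphi phi_lipschitz phi_convex epsg_ge0 l_gt0
      g_error (x j) l_le_s mhat_gt0.
  have sy0 : 0 < dot s y by apply: lt_le_trans lo; rewrite mulr_gt0 ?dot_gt0.
  have [cos_gt0 psiS] := potential_direct_update symB pdB s0 mhat_gt0 lo hi.
  (* [s] is a positive multiple of [p], and [B *m s] is the same multiple of [- g (x j)]. *)
  have cosE : cos (angle s (B *m s)) = cos (theta j).
    by rewrite sE -scalemxAr Bp cos_angleZ// oppr_eq0.
  rewrite cosE in cos_gt0 psiS.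
  exists (direct_update B s y); split.
  - exact: direct_update_sym.
  - exact: direct_update_posdef.
  - by rewrite HS; exact: bfgs_update_inv.
  rewrite card_fset_set_setIIS natrD -natr1 -/(Jk j).
  case: asboolP => [_|/negP]; rewrite /= ?addr0.
    (* For [j] in [J] the count is unchanged and the cosine term is merely dropped. *)
    have : ln (cos (theta j)) <= 0 by rewrite ln_le0// cos_le1.
    by move: psiS psiB; rewrite -/C; lra.
  rewrite -ltNge => bad.
  (* Outside [J], twice this logarithm pays for the extra [beta0]. *)
  have : ln (cos (theta j)) <= - beta0 / 2.
    by rewrite -[leRHS]expRK ler_ln ?posrE ?expR_gt0// ltW.
  by move: psiS psiB; rewrite -/C; lra.
have [B [symB pdB _]] := inv k.
have := potential_ge_dim symB pdB; have := ler0n R d.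
(* Absorbing [potential B0] into [k%:R * potential B0] requires [k] to be at least 1. *)
case: k => [|k]; first by rewrite mulr0.
set N := #|` _|%:R => d_ge0 psi_ge psi_le.
have psiC_gt0 : 0 < potential B0 + C by apply: ltr_pwDl.
have : (k.+1%:R - N) * beta0 <= k.+1%:R * (potential B0 + C).
  have : potential B0 <= k.+1%:R * potential B0.
    by rewrite ler_peMl ?ler1n// ltW.
  by lra.
(* Cancelling [potential B0 + C] leaves [k.+1%:R - N <= k.+1%:R * (1 - q)]. *)
rewrite beta0E mulrA ler_pdivrMr ?subr_gt0// mulrAC ler_pM2r//; lra.
Qed.
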